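(* Let $\mathcal{A} \in \mathbb{C}^{n \times n \times p}$, and let $f: \mathbb{C} \to \mathbb{C}$ be defined on a region in the complex plane containing the spectrum of $\mathtt{bcirc}(\mathcal{A})$. For part (iv), assume that $\mathcal{A}$ has an eigendecomposition $\mathcal{A} = \mathcal{X} * \mathcal{D} * \mathcal{X}^{-1}$, with $\mathcal{D} \in \mathbb{C}^{n\times n\times p}$ f-diagonal, and with $\mathcal{A} * \vec{\mathcal{X}}_i = \mathcal{D} * \vec{\mathcal{X}}_i = \vec{\mathcal{X}}_i * \mathbf{d}_i$ for $i = 1,\ldots,n$, where $\vec{\mathcal{X}}_i \in \mathbb{C}^{n \times 1 \times p}$ are the lateral slices of $\mathcal{X}$ and $\mathbf{d}_i \in \mathbb{C}^{1\times 1\times p}$ are the diagonal tube fibers of $\mathcal{D}$. Then it holds that (i) $f(\mathcal{A})$ commutes with $\mathcal{A}$ (with respect to the t-product $*$); (ii) $f(\mathcal{A}^* ) = f(\mathcal{A})^*$; (iii) $f(\mathcal{X} * \mathcal{A} * \mathcal{X}^{-1}) = \mathcal{X} * f(\mathcal{A}) * \mathcal{X}^{-1}$ (for $\mathcal{X} \in \mathbb{C}^{n\times n\times p}$ invertible with respect to the t-product); and (iv) $f(\mathcal{D}) * \vec{\mathcal{X}}_i = \vec{\mathcal{X}}_i * f(\mathbf{d}_i)$ for all $i = 1, \ldots, n$.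
   Context: For a third-order tensor $\mathcal{A} \in \mathbb{C}^{m \times n \times p}$, let $A^{(k)} = \mathcal{A}(:,:,k) \in \mathbb{C}^{m\times n}$, $k = 1,\ldots,p$, denote its frontal slices. Define $\mathtt{unfold}(\mathcal{A}) \in \mathbb{C}^{mp \times n}$ as the block column with blocks $A^{(1)}, A^{(2)}, \ldots, A^{(p)}$ from top to bottom; $\mathtt{fold}$ is its inverse, $\mathtt{fold}(\mathtt{unfold}(\mathcal{A})) = \mathcal{A}$. Define $\mathtt{bcirc}(\mathcal{A}) \in \mathbb{C}^{mp \times np}$ as the block circulant matrix whose $(i,j)$ block ($1 \le i,j \le p$) is $A^{(k)}$ with $k \in \{1,\ldots,p\}$, $k \equiv i-j+1 \pmod p$; its first block column is $\mathtt{unfold}(\mathcal{A})$. The t-product of $\mathcal{A} \in \mathbb{C}^{m \times n \times p}$ and $\mathcal{B} \in \mathbb{C}^{n \times s \times p}$ is $\mathcal{A} * \mathcal{B} := \mathtt{fold}(\mathtt{bcirc}(\mathcal{A})\,\mathtt{unfold}(\mathcal{B})) \in \mathbb{C}^{m \times s \times p}$. The identity tensor $\mathcal{I}_{n\times n\times p}$ has first frontal slice $I_{n \times n}$ and all other frontal slices zero; $\mathcal{X}, \mathcal{Y} \in \mathbb{C}^{n\times n\times p}$ are inverses of each other (written $\mathcal{Y} = \mathcal{X}^{-1}$) if $\mathcal{X} * \mathcal{Y} = \mathcal{Y} * \mathcal{X} = \mathcal{I}_{n\times n\times p}$. The tensor transpose $\mathcal{A}^* \in \mathbb{C}^{n\times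 m\times p}$ is obtained by taking the conjugate transpose of each frontal slice of $\mathcal{A}$ and then reversing the order of the second through $p$th transposed slices. (A superscript $*$ denotes this transpose; $*$ between two tensors denotes the t-product.) The lateral slices of $\mathcal{X}$ are $\vec{\mathcal{X}}_i = \mathcal{X}(:,i,:)$. A tensor $\mathcal{D} \in \mathbb{C}^{n\times n\times p}$ is f-diagonal if each of its frontal slices is a diagonal matrix; its diagonal tube fibers are $\mathbf{d}_i = \mathcal{D}(i,i,:) \in \mathbb{C}^{1\times1\times p}$. Matrix functions: for a square matrix $M$ with distinct eigenvalues $\lambda_1,\ldots,\lambda_N$, where $n_j$ is the size of the largest Jordan block of $\lambda_j$, a scalar function $f$ is defined on the spectrum of $M$ if the values $f^{(k)}(\lambda_j)$ exist for $k = 0,\ldots,n_j - 1$, $j = 1,\ldots,N$. Then $f(M) := q(M)$, where $q$ is the unique Hermite interpolating polynomial of degree less than $\sum_j n_j$ with $q^{(k)}(\lambda_j) = f^{(k)}(\lambda_j)$ for all such $k, j$ (equivalently, $f(M)$ is given by the Jordan form definition). Tensor t-function: for $\mathcal{A} \in \mathbb{C}^{n\times n\times p}$ (including $n=1$, the case of tube fibers), $f(\mathcal{A}) := \mathtt{fold}\big(f(\mathtt{bcirc}(\mathcal{A}))\,\mathbf{E}_1\big) \in \mathbb{C}^{n \times n \times p}$, where $f(\mathtt{bcirc}(\mathcal{A}))$ is the matrix function and $\mathbf{E}_1 = \mathtt{unfold}(\mathcal{I}_{n\times n\times p}) \in \mathbb{C}^{np\times n}$.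
   Formalization: Part (ii) fails as printed (n = p = 1, f constantly i); it is proved assuming the region also contains the spectrum of bcirc(A^* ) and f(conj z) = conj f(z) whenever z and conj z both lie in the region. *)

(* Defs.v *)
From HB Require Import structures.
From mathcomp Require Import all_boot all_order all_algebra.
From mathcomp Require Import complex.
From mathcomp Require Import all_classical all_reals topology normedtype.
From mathcomp Require Import derive.

Set Implicit Arguments.
Unset Strict Implicit.
Unset Printing Implicit Defensive.

Import Order.TTheory GRing.Theory Num.Theory.
Import numFieldNormedType.Exports.

Local Open Scope classical_set_scope.
Local Open Scope ring_scope.

Section MatrixFunctions.

Variable C : numClosedFieldType.

Definition spectrum N (M : 'M[C]_N) : set C := [set z | eigenvalue M z].

Definition jordan_block (z : C) d : 'M[C]_d :=
  \matrix_(i < d, j < d) (if j == i then z else if j == i.+1 :> nat then 1 else 0).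

(* The sizes [N] and [\sum_i d i] are equal only propositionally, so the
   change of basis is a rectangular matrix [P] with two-sided inverse [Q]. *)
Definition is_jordan_form N (M : 'M[C]_N) k (lam : 'I_k -> C) (d : 'I_k -> nat)
    : Prop :=
  (forall i, (0 < d i)%N) /\
  exists (P : 'M[C]_(N, \sum_(i < k) d i)) (Q : 'M[C]_(\sum_(i < k) d i, N)),
    [/\ P *m Q = 1%:M, Q *m P = 1%:M
      & M = P *m (\mxdiag_(i < k) jordan_block (lam i) (d i)) *m Q].

(* Every [M] has a Jordan form and the maximum does not depend on the one
   chosen, so the default value of [xget] is never used. *)
Definition largest_jordan_block N (M : 'M[C]_N) (z : C) : nat :=
  xget 0%N [set m | exists k (lam : 'I_k -> C) (d : 'I_k -> nat),
    is_jordan_form M lam d /\ m = (\max_(i < k | lam i == z) d i)%N].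

(* [derive1n] is total: existence of the [k]-th complex derivative at [z]
   requires the lower-order ones to exist in a neighbourhood of [z]. *)
Fixpoint has_derivn (k : nat) (f : C -> C) (z : C) : Prop :=
  if k is k'.+1 then
    (\forall w \near z, has_derivn k' f w) /\ derivable (derive1n k' f) z 1
  else True.

Definition defined_on_spectrum N (f : C -> C) (M : 'M[C]_N) : Prop :=
  forall z k, spectrum M z -> (k < largest_jordan_block M z)%N ->
    has_derivn k f z.

(* [size q] is the degree of [q] plus one. *)
Definition is_hermite_interpolant N (f : C -> C) (M : 'M[C]_N) (q : {poly C})
    : Prop :=
  (size q <= \big[addn/0]_(z \in spectrum M) largest_jordan_block M z)%N /\
  forall z k, spectrum M z -> (k < largest_jordan_block M z)%N ->
    (derivn k q).[z] = derive1n k f z.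

(* [horner_mx] requires a size of the form [n.+1], which the size
   [\sum_(k < p.+1) n] of a block circulant matrix is not. *)
Definition mx_horner N (M : 'M[C]_N) (q : {poly C}) : 'M[C]_N :=
  \sum_(i < size q) q`_i *: M ^+ i.

Definition matfun N (f : C -> C) (M : 'M[C]_N) : 'M[C]_N :=
  mx_horner M (xget 0 [set q | is_hermite_interpolant f M q]).

Definition region (Omega : set C) : Prop := open Omega /\ connected Omega.

End MatrixFunctions.

Definition tensor (C : Type) (m n p : nat) := {ffun 'I_p -> 'M[C]_(m, n)}.

(* The third dimension is [p.+1], so that slice indices form the cyclic group
   ['I_p.+1]; they are numbered from 0, i.e. [A k] is the slice A^(k+1). *)
Section Tensors.

Variable C : numClosedFieldType.

Definition unfold m n p (A : tensor C m n p) : 'M[C]_(\sum_(k < p) m, n) :=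
  \mxcol_(k < p) A k.

Definition fold m n p (B : 'M[C]_(\sum_(k < p) m, n)) : tensor C m n p :=
  [ffun k => submxcol B k].

Definition bcirc m n p (A : tensor C m n p.+1) :
    'M[C]_(\sum_(i < p.+1) m, \sum_(j < p.+1) n) :=
  \mxblock_(i < p.+1, j < p.+1) A (i - j).

Definition tprod m n s p (A : tensor C m n p.+1) (B : tensor C n s p.+1) :
    tensor C m s p.+1 :=
  fold (bcirc A *m unfold B).

Definition tid n p : tensor C n n p.+1 :=
  [ffun k => if k == 0 then 1%:M else 0].

Definition tinverse n p (X Y : tensor C n n p.+1) : Prop :=
  tprod X Y = tid n p /\ tprod Y X = tid n p.

(* [- k] is taken modulo [p.+1]: it fixes slice 0 and reverses the others. *)
Definition tadj m n p (A : tensor C m n p.+1) : tensor C n m p.+1 :=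
  [ffun k => map_mx Num.conj (A (- k))^T].

Definition lateral m n p (X : tensor C m n p) (i : 'I_n) : tensor C m 1 p :=
  [ffun k => col i (X k)].

Definition tube m n p (D : tensor C m n p) (i : 'I_m) (j : 'I_n) :
    tensor C 1 1 p :=
  [ffun k => (D k i j)%:M].

Definition fdiagonal n p (D : tensor C n n p) : Prop :=
  forall k, is_diag_mx (D k).

Definition tfun n p (f : C -> C) (A : tensor C n n p.+1) : tensor C n n p.+1 :=
  fold (matfun f (bcirc A) *m unfold (tid n p)).

End Tensors.

Arguments tid {C} n p.

Notation "A *t B" := (tprod A B) (at level 40, left associativity) : ring_scope.

(* Main.v *)
Require Import Defs.
From HB Require Import structures.
From mathcomp Require Import all_boot all_order all_algebra.
From mathcomp Require Import perm spectral mxpoly complex zify ring.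
From mathcomp Require Import all_classical all_reals topology normedtype.
From mathcomp Require Import derive.


(** Block circulant matrices form an algebra isomorphic to that of the tensors
    under the t-product, the isomorphism being [bcirc]; moreover [bcirc] turns
    the tensor transpose into the conjugate transpose.  A matrix function of
    [bcirc A] is a polynomial in [bcirc A], hence is again block circulant, so
    that [bcirc (tfun f A) = matfun f (bcirc A)] ([bcirc_tfun]).  As [bcirc] is
    injective, each of the four claims is a claim about functions of matrices.

    Part (i) holds because a polynomial in a matrix commutes with it.  For
    part (iii), similar matrices have the same spectrum and the same Jordan
    forms, hence the same interpolation problem ([matfun_similar]).

    For part (ii), conjugation is compatible with [f] on the open set of the
    points of [Omega] whose conjugate is in [Omega], which contains the
    spectrum; this passes to the derivatives of [f] ([derive1n_conj]).  The
    adjoint of a matrix has the conjugate eigenvalues with Jordan blocks of the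
    same sizes, because reversing its basis transposes a Jordan block.  Hence
    conjugating the coefficients of an interpolant for [M] gives one for the
    adjoint of [M] ([hermite_interpolant_adj]), and since an interpolant is
    unique ([hermite_interpolant_unique]) it is the one that defines the matrix
    function ([matfun_adj]).

    For part (iv), an f-diagonal tensor commutes with its transpose under the
    t-product, so its block circulant matrix is normal and the spectral theorem
    diagonalizes it ([fdiagonal_diagonalizable]); this covers both [D] and its
    tubes.  On a diagonalizable matrix the Jordan blocks have size one, the
    interpolation is Lagrange interpolation, and [f] acts on the eigenvalues
    ([matfun_diag]).  In bases of eigenvectors a matrix [L] with [M L = L M']
    has a nonzero entry only between equal eigenvalues of [M] and [M'], so it
    also intertwines [f M] and [f M'] ([matfun_diag_intertwine]); the claim is
    the case where [L] comes from a lateral slice of [X]. *)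

Set Implicit Arguments.
Unset Strict Implicit.
Unset Printing Implicit Defensive.

Import Order.TTheory GRing.Theory Num.Theory.
Import numFieldNormedType.Exports.

Local Open Scope classical_set_scope.
Local Open Scope ring_scope.

(** * The algebra of block circulant matrices *)

Section TensorAlgebra.

Variable C : numClosedFieldType.

Lemma tprodE m n s p (A : tensor C m n p.+1) (B : tensor C n s p.+1) k :
  (A *t B) k = \sum_j (A (k - j) *m B j).
Proof. by rewrite ffunE /bcirc /unfold mul_mxblock_mxrow mxcolK. Qed.

Lemma bcirc_tprod m n s p (A : tensor C m n p.+1) (B : tensor C n s p.+1) :
  bcirc (A *t B) = bcirc A *m bcirc B.
Proof.
rewrite /bcirc mul_mxblock; apply: eq_mxblock => i j.
rewrite tprodE (reindex_inj (addIr (- j))) /=.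
by apply: eq_bigr => l _; rewrite opprB subrKA.
Qed.

Lemma bcirc_inj m n p : injective (@bcirc C m n p).
Proof.
move=> A B; rewrite /bcirc => /eq_mxblockP eqAB; apply/ffunP => k.
by have := eqAB k 0; rewrite subr0.
Qed.

Lemma tprod1 m n p (A : tensor C m n p.+1) : A *t tid n p = A.
Proof.
apply/ffunP => k; rewrite tprodE (bigD1 0) //= ffunE eqxx subr0 mulmx1.
by rewrite big1 ?addr0 // => j /negbTE j0; rewrite ffunE j0 mulmx0.
Qed.

Lemma bcirc_tid n p : bcirc (tid n p) = 1%:M :> 'M[C]__.
Proof.
rewrite -(mxdiagZ (p_ := fun=> n)); apply: eq_mxblock => i j.
by rewrite ffunE subr_eq0 conform_mx_id.
Qed.

Lemma bcirc_tadj m n p (A : tensor C m n p.+1) :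
  bcirc (tadj A) = map_mx Num.conj (bcirc A)^T.
Proof.
by apply/matrixP => s t; rewrite !(mxE, ffunE) opprB.
Qed.

End TensorAlgebra.

(** * Polynomials in a matrix *)

Section MatrixPolynomials.

Variable C : numClosedFieldType.

(** Used with [L] square for commutation, with [L] invertible for similarity and
    with [L] a matrix of eigenvectors for diagonalization. *)
Lemma mx_horner_intertwine N N' (M : 'M[C]_N) (M' : 'M[C]_N')
    (L : 'M[C]_(N, N')) q :
  M *m L = L *m M' -> mx_horner M q *m L = L *m mx_horner M' q.
Proof.
move=> ML; rewrite /mx_horner mulmx_suml mulmx_sumr; apply: eq_bigr => i _.
rewrite -scalemxAl -scalemxAr; congr (_ *: _).
elim: (i : nat) => [|k IHk]; first by rewrite mul1mx mulmx1.
by rewrite !exprS -[_ *m L]mulmxA IHk mulmxA ML -mulmxA.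
Qed.

Lemma mx_horner_diag N (r : 'rV[C]_N) q :
  mx_horner (diag_mx r) q = diag_mx (map_mx (horner q) r).
Proof.
have powE k : diag_mx r ^+ k = diag_mx (map_mx (fun x => x ^+ k) r).
  elim: k => [|k IHk].
    by apply/matrixP => i j; rewrite expr0 !mxE expr0.
  rewrite exprS IHk -mulmxE; apply/matrixP => i j.
  by rewrite mul_diag_mx !mxE exprS mulrnAr.
apply/matrixP => i j; rewrite /mx_horner summxE !mxE horner_coef -sumrMnl.
by apply: eq_bigr => k _; rewrite powE !mxE mulrnAr.
Qed.

Lemma mx_horner_adj N (M : 'M[C]_N) q :
  mx_horner (map_mx Num.conj M^T) (map_poly Num.conj q) =
  map_mx Num.conj (mx_horner M q)^T.
Proof.
rewrite /mx_horner size_map_poly linear_sum /= raddf_sum /=.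
apply: eq_bigr => i _; rewrite coef_map linearZ /= map_mxZ; congr (_ *: _).
elim: (i : nat) => [|k IHk].
  by rewrite !expr0 trmx1 map_mx1.
by rewrite exprS exprSr IHk [in RHS]trmx_mul map_mxM.
Qed.

(** The block circulant matrices form a subalgebra, hence are stable under
    polynomials. *)
Lemma bcirc_mx_horner n p (A : tensor C n n p.+1) q :
  exists T, mx_horner (bcirc A) q = bcirc T.
Proof.
have powE k : exists T, bcirc A ^+ k = bcirc T.
  elim: k => [|k [T AT]]; first by exists (tid n p); rewrite bcirc_tid.
  by exists (A *t T); rewrite bcirc_tprod exprS AT.
rewrite /mx_horner; apply: (big_ind (fun M => exists T, M = bcirc T))
  => [|_ _ [T ->] [U ->]|i _].
- exists [ffun=> 0]; rewrite -[LHS]mxblock0; apply: eq_mxblock => i j.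
  by rewrite ffunE.
- exists [ffun k => T k + U k]; rewrite -mxblockD; apply: eq_mxblock => i j.
  by rewrite ffunE.
- have [T ->] := powE i; exists [ffun k => q`_i *: T k].
  by apply/matrixP => s t; rewrite !(mxE, ffunE).
Qed.

(** [tfun] only keeps the first block column of the matrix function, which
    determines it because the matrix function is block circulant. *)
Lemma bcirc_tfun n p f (A : tensor C n n p.+1) :
  bcirc (tfun f A) = matfun f (bcirc A).
Proof.
have [T fT] : exists T, matfun f (bcirc A) = bcirc T by exact: bcirc_mx_horner.
by rewrite fT /tfun fT -/(tprod _ _) tprod1.
Qed.

End MatrixPolynomials.

(** * Invariance under similarity *)

Section Similarity.

Variable C : numClosedFieldType.

(** [L] carries a left eigenvector of [M] to one of [M'], nonzero because [L]
    has a right inverse. *)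
Lemma spectrum_intertwine N N' (M : 'M[C]_N) (M' : 'M[C]_N')
    (L : 'M[C]_(N, N')) (K : 'M[C]_(N', N)) :
  M *m L = L *m M' -> L *m K = 1%:M -> spectrum M `<=` spectrum M'.
Proof.
move=> ML LK z /eigenvalueP[v vM v0]; apply/eigenvalueP; exists (v *m L).
  by rewrite -mulmxA -ML mulmxA vM scalemxAl.
apply: contraNneq v0 => /(congr1 (mulmx^~ K)).
by rewrite -mulmxA LK mulmx1 mul0mx => ->.
Qed.

Lemma jordan_form_similar N (M P Q : 'M[C]_N) k (lam : 'I_k -> C) d :
  P *m Q = 1%:M -> Q *m P = 1%:M ->
  is_jordan_form M lam d -> is_jordan_form (P *m M *m Q) lam d.
Proof.
move=> PQ QP [d_gt0 [P1 [Q1 [PQ1 QP1 ->]]]]; split=> //.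
exists (P *m P1), (Q1 *m Q); split; last by rewrite !mulmxA.
  by rewrite mulmxA -(mulmxA P) PQ1 mulmx1.
by rewrite mulmxA -(mulmxA Q1) QP mulmx1.
Qed.

(** Similar matrices have the same eigenvalues and the same Jordan forms, so they
    pose the same interpolation problem, and [xget] selects the same solution. *)
Lemma matfun_similar N f (M P Q : 'M[C]_N) :
  P *m Q = 1%:M -> Q *m P = 1%:M ->
  matfun f (P *m M *m Q) = P *m matfun f M *m Q.
Proof.
move=> PQ QP.
have MPQ : P *m M *m Q *m P = P *m M by rewrite -mulmxA QP mulmx1.
have MQP : Q *m (P *m M *m Q) = M *m Q by rewrite !mulmxA QP mul1mx.
have MK : Q *m (P *m M *m Q) *m P = M by rewrite MQP -mulmxA QP mulmx1.
have specE : spectrum (P *m M *m Q) = spectrum M.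
  apply/seteqP; split; first exact: spectrum_intertwine MPQ PQ.
  exact: spectrum_intertwine (esym MQP) QP.
have blockE : largest_jordan_block (P *m M *m Q) = largest_jordan_block M.
  apply/funext => z; congr (xget _ _); apply/seteqP; split=> m /=.
    move=> [k [lam [d [/(jordan_form_similar QP PQ)]]]].
    by rewrite MK => Mform mE; exists k, lam, d.
  move=> [k [lam [d [/(jordan_form_similar PQ QP) Mform mE]]]].
  by exists k, lam, d.
rewrite /matfun /is_hermite_interpolant specE blockE.
by rewrite -[LHS]mulmx1 -PQ mulmxA (mx_horner_intertwine _ MPQ).
Qed.

End Similarity.

(** * Uniqueness of the Hermite interpolant *)

Section Hermite.

Variable C : numClosedFieldType.

Lemma spectrum_finite N (M : 'M[C]_N) :
  exists2 s : seq C, uniq s & spectrum M = [set` s].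
Proof.
have [s sE] := closed_field_poly_normal (char_poly M).
exists (undup s); first exact: undup_uniq.
apply/seteqP; split=> z /=.
  rewrite /spectrum /= eigenvalue_root_char sE mem_undup.
  by rewrite (monicP (char_poly_monic M)) scale1r root_prod_XsubC.
rewrite /spectrum /= eigenvalue_root_char sE mem_undup.
by rewrite (monicP (char_poly_monic M)) scale1r root_prod_XsubC.
Qed.

(** Taylor expansion at [z]; the Taylor coefficients are the derivatives up to
    factorials, which are invertible in characteristic zero. *)
Lemma dvdp_derivn_root (m : nat) (r : {poly C}) z :
  (forall k, (k < m)%N -> (r^`(k)).[z] = 0) -> ('X - z%:P) ^+ m %| r.
Proof.
move=> r0.
have -> : r = \sum_(i < size r^:P) (r^`N(i)).[z]%:P * ('X - z%:P) ^+ i.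
  (* Taylor expansion of the lift of [r] to polynomials over [{poly C}] *)
  have {1}-> : r = r^:P.[z%:P + ('X - z%:P)].
    by rewrite addrC subrK; apply/esym/comp_polyXr.
  rewrite nderiv_taylor; last exact: mulrC.
  by apply: eq_bigr => i _; rewrite nderivn_map horner_map.
elim/big_ind: _ => [|g h|i _]; [exact: dvdp0 | exact: dvdp_add |].
have [im|mi] := ltnP i m; last by rewrite dvdp_mull // dvdp_exp2l.
suff -> : (r^`N(i)).[z] = 0 by rewrite mul0r dvdp0.
have /eqP := r0 _ im; rewrite nderivn_def hornerMn mulrn_eq0.
by rewrite -leqn0 leqNgt fact_gt0 => /eqP.
Qed.

(** The difference of two interpolants is divisible by the product of the
    [('X - z) ^+ m z] over the spectrum, whose degree it cannot reach. *)
Lemma hermite_interpolant_unique N f (M : 'M[C]_N) q q' :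
  is_hermite_interpolant f M q -> is_hermite_interpolant f M q' -> q = q'.
Proof.
move=> [szq qE] [szq' q'E].
have [s uniq_s specE] := spectrum_finite M.
set m := largest_jordan_block M in szq qE szq' q'E.
apply/eqP; rewrite -subr_eq0; apply: contraT => r0.
have dvd_s : \prod_(z <- s) ('X - z%:P) ^+ m z %| q - q'.
  have : {subset s <= s} by [].
  elim: {1 2 4}s uniq_s => [|z t IHt] /=; first by rewrite big_nil dvd1p.
  move=> /andP[zt uniq_t] sub_s; rewrite big_cons Gauss_dvdp.
    rewrite IHt ?andbT // => [|y yt]; last by rewrite sub_s ?inE ?yt ?orbT.
    apply: dvdp_derivn_root => k km; rewrite derivnB hornerD hornerN.
    have Mz : spectrum M z by rewrite specE /= sub_s ?mem_head.
    by rewrite qE ?q'E ?subrr.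
  rewrite coprimep_expl // big_seq; elim/big_rec: _ => [|y g yt zg].
    by rewrite coprimep1.
  rewrite coprimepMr zg andbT coprimep_expr // coprimep_XsubC root_XsubC.
  by apply: contraNneq zt => <-.
have := dvdp_leq r0 dvd_s; rewrite leqNgt => /negP[].
apply: leq_ltn_trans (size_polyD _ _) _; rewrite size_polyN gtn_max.
have -> : size (\prod_(z <- s) ('X - z%:P) ^+ m z) = (\sum_(z <- s) m z).+1.
  elim: (s) => [|z t IHt]; first by rewrite !big_nil size_poly1.
  rewrite !big_cons size_mul ?IHt ?size_exp_XsubC ?addSn ?addnS //.
    by rewrite expf_neq0 ?polyXsubC_eq0.
  by rewrite -size_poly_gt0 IHt.
by rewrite !ltnS (fsbig_seq _ m uniq_s) -specE szq szq'.
Qed.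

End Hermite.

(** * Conjugate transposition *)

Section Adjoint.

Variable C : numClosedFieldType.

Local Open Scope sesquilinear_scope.

Lemma adjmxM m n s (A : 'M[C]_(m, n)) (B : 'M[C]_(n, s)) :
  (A *m B)^t* = B^t* *m A^t*.
Proof. by rewrite trmx_mul map_mxM. Qed.

Lemma adjmx1 n : (1%:M : 'M[C]_n)^t* = 1%:M.
Proof. by rewrite trmx1 map_mx1. Qed.

Lemma spectrum_adj N (M : 'M[C]_N) z :
  spectrum M z -> spectrum (M^t*) (z^*).
Proof.
rewrite /spectrum /= !eigenvalue_root_char -map_char_poly fmorph_root.
rewrite /char_poly /char_poly_mx -(det_tr (_ - _)) linearB /=.
by rewrite tr_scalar_mx map_trmx.
Qed.

Lemma mul_mxdiag k (d : 'I_k -> nat) (A B : forall i, 'M[C]_(d i)) :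
  \mxdiag_i A i *m \mxdiag_i B i = \mxdiag_i (A i *m B i).
Proof.
rewrite {2}/mxdiag mul_mxdiag_mxblock; apply: eq_mxblock => i j.
by case: eqVneq => [<-|_]; rewrite ?conform_mx_id ?mulmx0.
Qed.

Lemma map_mxdiag k (d : 'I_k -> nat) (A : forall i, 'M[C]_(d i))
    (g : C -> C) :
  g 0 = 0 -> map_mx g (\mxdiag_i A i) = \mxdiag_i map_mx g (A i).
Proof.
move=> g0; transitivity (\mxblock_(i, j)
    map_mx g (if i == j then conform_mx 0 (A i) else 0 : 'M[C]_(d i, d j))).
  by apply/matrixP => s t; rewrite !mxE.
apply: eq_mxblock => i j; case: eqVneq => [<-|_]; rewrite ?conform_mx_id //.
by apply/matrixP => a b; rewrite !mxE.
Qed.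

(** The transpose of a Jordan block is the same block in the reversed basis;
    [S] below reverses the basis of each block. *)
Lemma jordan_form_adj N (M : 'M[C]_N) k (lam : 'I_k -> C) d :
  is_jordan_form M lam d ->
  is_jordan_form (M^t*) (fun i => (lam i)^*) d.
Proof.
move=> [d_gt0 [P [Q [PQ QP ->]]]]; split=> //.
pose S : 'M[C]__ := \mxdiag_(i < k) perm_mx (perm (@rev_ord_inj (d i))).
have SS : S *m S = 1%:M.
  rewrite mul_mxdiag -(mxdiagZ (p_ := d)); apply: eq_mxdiag => i.
  rewrite -perm_mxM; apply/matrixP => a b.
  by rewrite !mxE permM !permE rev_ordK.
have JE : (\mxdiag_(i < k) jordan_block (lam i) (d i))^t* =
    S *m (\mxdiag_(i < k) jordan_block (lam i)^* (d i)) *m S.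
  rewrite tr_mxdiag !mul_mxdiag map_mxdiag ?rmorph0 //; apply: eq_mxdiag => i.
  have sV : perm (@rev_ord_inj (d i)) = (perm (@rev_ord_inj (d i)))^-1%g.
    apply/permP => a; apply: (@perm_inj _ (perm (@rev_ord_inj (d i)))).
    by rewrite permKV !permE rev_ordK.
  rewrite {2}sV -row_permE -col_permE; apply/matrixP => a b.
  rewrite !mxE !permE (inj_eq rev_ord_inj) [b == a]eq_sym.
  case: eqVneq => // _; rewrite /= -subSn ?ltn_ord // subSS.
  have -> : (d i - b.+1 == d i - a)%N = (a == b.+1 :> nat).
    by case: a b => [a /= lta] [b /= ltb]; apply/eqP/eqP; lia.
  by case: eqP => _; rewrite ?rmorph0 ?rmorph1.
exists (Q^t* *m S), (S *m P^t*); split.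
- by rewrite mulmxA -[Q^t* *m S *m S]mulmxA SS mulmx1 -adjmxM PQ adjmx1.
- by rewrite mulmxA -[S *m _ *m _]mulmxA -adjmxM QP adjmx1 mulmx1.
by rewrite !adjmxM JE !mulmxA.
Qed.

Lemma largest_jordan_block_adj N (M : 'M[C]_N) z :
  largest_jordan_block (M^t*) z^* = largest_jordan_block M z.
Proof.
have sub (M' : 'M[C]_N) z' m :
    (exists k (lam : 'I_k -> C) (d : 'I_k -> nat),
      is_jordan_form M' lam d /\ m = (\max_(i < k | lam i == z') d i)%N) ->
    (exists k (lam : 'I_k -> C) (d : 'I_k -> nat),
      is_jordan_form (M'^t*) lam d /\
      m = (\max_(i < k | lam i == z'^*) d i)%N).
  move=> [k [lam [d [/jordan_form_adj Mform ->]]]].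
  exists k, (fun i => (lam i)^*), d; split=> //; apply: eq_bigl => i.
  by rewrite (inj_eq (can_inj conjCK)).
congr (xget _ _); apply/seteqP; split=> m /=; last exact: sub.
by move=> /sub; rewrite trmxCK conjCK.
Qed.

Lemma hermite_interpolant_adj N f (M : 'M[C]_N) q :
  (forall z k, spectrum M z -> (k < largest_jordan_block M z)%N ->
    derive1n k f z^* = (derive1n k f z)^*) ->
  is_hermite_interpolant f M q ->
  is_hermite_interpolant f (M^t*) (map_poly Num.conj q).
Proof.
move=> fC [szq qE]; have specC z : spectrum (M^t*) z -> spectrum M z^*.
  by move=> /spectrum_adj; rewrite trmxCK.
have blockC z : largest_jordan_block (M^t*) z = largest_jordan_block M z^*.
  by rewrite -[in LHS](conjCK z) largest_jordan_block_adj.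
split=> [|z k Mz]; last first.
  rewrite blockC => km; rewrite derivn_map -[in LHS](conjCK z) horner_map /=.
  by rewrite qE // -?fC ?conjCK //; apply: specC.
rewrite size_map_poly; apply: leq_trans szq _.
rewrite (@reindex_fsbig _ _ _ _ _ Num.conj (spectrum (M^t*))).
  rewrite (@eq_fsbigr _ _ _ _ _ (largest_jordan_block (M^t*))) //.
split=> [z /specC //|z z' _ _ /(can_inj conjCK) //|z Mz].
by exists z^*; rewrite ?conjCK //; apply: spectrum_adj.
Qed.

(** The default value of [xget] is harmless: by involutivity of the adjoint, [M]
    has an interpolant if and only if its adjoint does, and the default
    polynomial 0 is its own conjugate. *)
Lemma matfun_adj N f (M : 'M[C]_N) :
  (forall z k, spectrum M z -> (k < largest_jordan_block M z)%N ->
    derive1n k f z^* = (derive1n k f z)^*) ->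
  matfun f (M^t*) = (matfun f M)^t*.
Proof.
move=> fC; rewrite /matfun.
have [[q Mq]|noq] := pselect (exists q, is_hermite_interpolant f M q).
  have qE := xget_unique 0 Mq (fun r Mr => hermite_interpolant_unique Mr Mq).
  have MCq := hermite_interpolant_adj fC Mq.
  have qCE := xget_unique 0 MCq (fun r Mr => hermite_interpolant_unique Mr MCq).
  by rewrite qE qCE mx_horner_adj.
rewrite !xgetPN => [|q Mq|q Mq].
- by rewrite -mx_horner_adj map_poly0.
- by apply: noq; exists q.
apply: noq; exists (map_poly Num.conj q); rewrite -[M]trmxCK.
apply: hermite_interpolant_adj Mq => z k Mz.
rewrite -[in X in (_ < X)%N](conjCK z) largest_jordan_block_adj => km.
have Mzc : spectrum M z^* by rewrite -[M]trmxCK; apply: spectrum_adj.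
by rewrite -[LHS]conjCK -fC // conjCK.
Qed.

End Adjoint.

(** * Diagonalizable matrices *)

Section Diagonalizable.

Variable C : numClosedFieldType.

Lemma eigenvalue_diag N (r : 'rV[C]_N) z :
  reflect (exists j, r 0 j = z) (eigenvalue (diag_mx r) z).
Proof.
apply: (iffP eigenvalueP) => [[v vr v0]|[j <-]].
  have /rV0Pn[j vj0] := v0; exists j; apply: (mulfI vj0).
  by have /matrixP/(_ 0 j) := vr; rewrite mul_mx_diag !mxE mulrC [RHS]mulrC.
exists (delta_mx 0 j); last first.
  by apply/rV0Pn; exists j; rewrite mxE !eqxx oner_eq0.
by rewrite -rowE row_diag_mx.
Qed.

Lemma jordan_block_small z m :
  (m <= 1)%N -> jordan_block z m = diag_mx (const_mx z) :> 'M[C]_m.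
Proof.
move=> m1; apply/matrixP => a b; rewrite !mxE [b == a]eq_sym.
case: eqVneq => // _; case: eqP => // ba.
by case: a b ba => [a la] [b lb] /=; lia.
Qed.

(** The size [\sum_(i < N) 1] is only propositionally [N], so the decomposition is
    first transported along that equation. *)
Lemma diag_jordan_form N (M P Q : 'M[C]_N) r :
  P *m Q = 1%:M -> Q *m P = 1%:M -> M = P *m diag_mx r *m Q ->
  exists lam, is_jordan_form M lam (fun _ : 'I_N => 1%N).
Proof.
move=> PQ QP ->; have eN : N = (\sum_(i < N) 1)%N by rewrite sum1_card card_ord.
have [r' [P' [Q' [PQ' QP' <-]]]] : exists (r' : 'rV[C]_(\sum_(i < N) 1))
    (P' : 'M[C]_(N, \sum_(i < N) 1)) (Q' : 'M[C]_(\sum_(i < N) 1, N)),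
    [/\ P' *m Q' = 1%:M, Q' *m P' = 1%:M
      & P' *m diag_mx r' *m Q' = P *m diag_mx r *m Q].
  by case: _ / eN; exists r, P, Q.
exists (fun j => submxrow r' j 0 0); split=> //; exists P', Q'; split=> //.
congr (_ *m _ *m _); rewrite -[in LHS](submxrowK r') diag_mxrow.
apply: eq_mxdiag => j; rewrite jordan_block_small //; congr diag_mx.
by apply/rowP => a; rewrite [in RHS]mxE (ord1 a).
Qed.

(** A diagonal matrix has no Jordan chain of length two. *)
Lemma diag_no_chain N (r : 'rV[C]_N) (v w : 'rV[C]_N) c :
  v *m diag_mx r = c *: v + w -> w *m diag_mx r = c *: w -> w = 0.
Proof.
move=> vr wr; apply/rowP => j.
have /matrixP/(_ 0 j) := vr; have /matrixP/(_ 0 j) := wr.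
rewrite !mul_mx_diag !mxE => wj vj.
apply/eqP; rewrite -sqrf_eq0 expr2; apply/eqP.
have {1}-> : w 0 j = v 0 j * r 0 j - c * v 0 j by rewrite vj; ring.
by rewrite mulrBl -mulrA [r 0 j * _]mulrC wj; ring.
Qed.

(** The row [e t], the [t]-th basis vector of block [i], is selected by its value
    as a natural number rather than as an ordinal of ['I_(d i)]; thus [e (d i)]
    makes sense and is 0, and the last vector of the chain is an eigenvector. *)
Lemma jordan_chain k (lam : 'I_k -> C) d (i : 'I_k) t : (t < d i)%N ->
  let e s : 'rV[C]__ :=
    \mxrow_(j < k) \row_(b < d j) ((j == i) && (b == s :> nat))%:R in
  e t *m (\mxdiag_(j < k) jordan_block (lam j) (d j)) = lam i *: e t + e t.+1.
Proof.
move=> td /=; apply/matrixP => x s; rewrite mul_mxrow_mxdiag !mxE.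
move: (tagnat.sig1 s) (tagnat.sig2 s) => j b.
case: (eqVneq j i) b => [->|ji] b; last first.
  by rewrite big1 ?mulr0 ?addr0 // => a _; rewrite mxE mul0r.
rewrite (bigD1 (Ordinal td)) //= big1 => [|a at_]; last first.
  by rewrite mxE; move: at_; rewrite -val_eqE /= => /negbTE->; rewrite mul0r.
rewrite !mxE /= eqxx mul1r addr0 -val_eqE /=.
case: eqVneq => [->|bt]; first by rewrite mulr1 (ltn_eqF (ltnSn _)) addr0.
by rewrite mulr0 add0r; case: eqP.
Qed.

(** A block of size at least two contains a chain of length two, which a change
    of basis turns into one for the diagonal matrix. *)
Lemma diag_jordan_size N (M P Q : 'M[C]_N) r k (lam : 'I_k -> C) d :
  P *m Q = 1%:M -> Q *m P = 1%:M -> M = P *m diag_mx r *m Q ->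
  is_jordan_form M lam d -> forall i, d i = 1%N.
Proof.
move=> PQ QP -> [d_gt0 [P1 [Q1 [PQ1 QP1 ME]]]] i; apply/eqP.
rewrite eqn_leq d_gt0 andbT leqNgt; apply/negP => di.
set J := (\mxdiag_i _) in ME.
pose e s : 'rV[C]__ :=
  \mxrow_(j < k) \row_(b < d j) ((j == i) && (b == s :> nat))%:R.
have e1 : e (d i).-2 *m J = lam i *: e (d i).-2 + e (d i).-1.
  by rewrite jordan_chain /= ?prednK //; lia.
have e2 : e (d i).-1 *m J = lam i *: e (d i).-1.
  rewrite jordan_chain ?ltn_predL // prednK // -[RHS]addr0; congr (_ + _).
  apply/mxrowP => j; rewrite mxrowK submxrow0; apply/rowP => b; rewrite !mxE.
  by case: eqP b => //= -> b; rewrite ltn_eqF.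
have tr v : v *m Q1 *m P *m diag_mx r = v *m J *m Q1 *m P.
  have -> : diag_mx r = Q *m (P1 *m J *m Q1) *m P.
    by rewrite -ME !mulmxA QP mul1mx -mulmxA QP mulmx1.
  rewrite !mulmxA -[v *m Q1 *m P *m Q]mulmxA PQ mulmx1.
  by rewrite -[v *m Q1 *m P1]mulmxA QP1 mulmx1.
have w0 : e (d i).-1 *m Q1 *m P = 0.
  apply: (@diag_no_chain _ r (e (d i).-2 *m Q1 *m P) _ (lam i)).
    by rewrite tr e1 !mulmxDl -!scalemxAl.
  by rewrite tr e2 -!scalemxAl.
have : e (d i).-1 = 0.
  have := congr1 (fun u => u *m Q *m P1) w0; rewrite !mul0mx.
  by rewrite -[_ *m P *m Q]mulmxA PQ mulmx1 -mulmxA QP1 mulmx1.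
have lt : ((d i).-1 < d i)%N by rewrite ltn_predL.
move=> /(congr1 (fun u => submxrow u i 0 (Ordinal lt))).
by rewrite mxrowK submxrow0 !mxE !eqxx => /eqP; rewrite oner_eq0.
Qed.

(** All Jordan forms of [M] have blocks of size one, and a Jordan form is then
    diagonal, so that each eigenvalue occurs in it. *)
Lemma diag_largest_jordan_block N (M P Q : 'M[C]_N) r z :
  P *m Q = 1%:M -> Q *m P = 1%:M -> M = P *m diag_mx r *m Q ->
  spectrum M z -> largest_jordan_block M z = 1%N.
Proof.
move=> PQ QP ME Mz; rewrite /largest_jordan_block.
set S := [set _ | _].
have [k [lam [d [Mform ->]]]] : S (xget 0%N S).
  have [lam Mform] := diag_jordan_form PQ QP ME.
  by apply: xgetPex; eexists; exists N, lam, (fun=> 1%N).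
have d1 := diag_jordan_size PQ QP ME Mform.
case: Mform => _ [P1 [Q1 [PQ1 QP1 ME1]]].
have ED : \mxdiag_(i < k) jordan_block (lam i) (d i) =
    diag_mx (\mxrow_(i < k) const_mx (lam i)).
  by rewrite diag_mxrow; apply: eq_mxdiag => i; rewrite jordan_block_small ?d1.
have MP : M *m P1 = P1 *m diag_mx (\mxrow_(i < k) const_mx (lam i)).
  by rewrite ME1 ED -mulmxA QP1 mulmx1.
have /eigenvalue_diag[s] := spectrum_intertwine MP PQ1 Mz.
rewrite !mxE => lamz; apply/eqP; rewrite eqn_leq; apply/andP; split.
  by apply/bigmax_leqP => i _; rewrite d1.
by rewrite -(d1 (tagnat.sig1 s)); apply: (leq_bigmax_cond (F := d)); apply/eqP.
Qed.

(** Newton's scheme: a multiple of the polynomial vanishing at the previous nodes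
    corrects the value at the new one. *)
Lemma lagrange (s : seq C) (f : C -> C) : uniq s ->
  exists2 q : {poly C}, (size q <= size s)%N & {in s, forall z, q.[z] = f z}.
Proof.
elim: s => [|z s IHs] /=; first by exists 0; rewrite ?size_poly0.
move=> /andP[zs /IHs[q szq qE]]; pose g := \prod_(y <- s) ('X - y%:P).
have gz : g.[z] != 0 by rewrite -/(root _ _) root_prod_XsubC.
exists (q + ((f z - q.[z]) / g.[z]) *: g) => [|y].
  rewrite (leq_trans (size_polyD _ _)) // geq_max (leqW szq) /=.
  by rewrite (leq_trans (size_scale_leq _ _)) // size_prod_XsubC.
rewrite hornerD hornerZ inE => /predU1P[->|ys].
  by rewrite divfK // addrC subrK.
have /rootP-> : root g y by rewrite root_prod_XsubC.
by rewrite mulr0 addr0 qE.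
Qed.

(** The interpolation conditions only involve values of [f], since all Jordan
    blocks have size one, and [lagrange] solves them. *)
Lemma matfun_diag N f (M P Q : 'M[C]_N) r :
  P *m Q = 1%:M -> Q *m P = 1%:M -> M = P *m diag_mx r *m Q ->
  matfun f M = P *m diag_mx (map_mx f r) *m Q.
Proof.
move=> PQ QP ME.
have block1 z := @diag_largest_jordan_block _ _ _ _ _ z PQ QP ME.
have MP : M *m P = P *m diag_mx r by rewrite ME -mulmxA QP mulmx1.
have [q [szq qE] -> ] : exists2 q, is_hermite_interpolant f M q
    & matfun f M = mx_horner M q.
  exists (xget 0 [set q | is_hermite_interpolant f M q]) => //.
  apply: xgetPex; have [s uniq_s specE] := spectrum_finite M.
  have [q szq qE] := lagrange f uniq_s; exists q; split=> [|z k Mz].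
    apply: leq_trans szq _; rewrite specE -fsbig_seq // -sum1_size.
    rewrite big_seq [leqRHS]big_seq; apply: leq_sum => z zs.
    by rewrite block1 // specE.
  rewrite block1 // ltnS leqn0 => /eqP->; rewrite derivn0 qE //.
  by have := Mz; rewrite specE.
rewrite -[LHS]mulmx1 -PQ mulmxA (mx_horner_intertwine _ MP) mx_horner_diag.
congr (_ *m diag_mx _ *m _); apply/rowP => j; rewrite !mxE.
have Mr : spectrum M (r 0 j).
  have MQ : diag_mx r *m Q = Q *m M by rewrite ME !mulmxA QP mul1mx.
  by apply: (spectrum_intertwine MQ QP); apply/eigenvalue_diag; exists j.
by apply: (qE _ 0%N); rewrite ?block1.
Qed.

(** The matrix [W] of [L] in eigenbases satisfies [r i * W i j = W i j * r' j], so
    [W i j] vanishes unless [r i = r' j]; replacing [r] and [r'] by their images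
    under [f] keeps the equation true. *)
Lemma matfun_diag_intertwine N N' f (M P Q : 'M[C]_N) r (M' P' Q' : 'M[C]_N') r'
    (L : 'M[C]_(N, N')) :
  P *m Q = 1%:M -> Q *m P = 1%:M -> M = P *m diag_mx r *m Q ->
  P' *m Q' = 1%:M -> Q' *m P' = 1%:M -> M' = P' *m diag_mx r' *m Q' ->
  M *m L = L *m M' -> matfun f M *m L = L *m matfun f M'.
Proof.
move=> PQ QP ME PQ' QP' ME' ML.
rewrite (matfun_diag _ PQ QP ME) (matfun_diag _ PQ' QP' ME').
pose W := Q *m L *m P'.
have rW : diag_mx r *m W = W *m diag_mx r'.
  have -> : diag_mx r *m W = Q *m (M *m L) *m P'.
    by rewrite ME !mulmxA QP mul1mx.
  by rewrite ML ME' !mulmxA -[_ *m Q' *m P']mulmxA QP' mulmx1.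
have fW : diag_mx (map_mx f r) *m W = W *m diag_mx (map_mx f r').
  move: W rW => W rW; apply/matrixP => i j; have /matrixP/(_ i j) := rW.
  rewrite !mul_diag_mx !mul_mx_diag !mxE mulrC => eW.
  have [->|W0] := eqVneq (W i j) 0; first by rewrite mul0r mulr0.
  by rewrite (mulfI W0 eW) mulrC.
have LE : L = P *m W *m Q'.
  by rewrite /W !mulmxA PQ mul1mx -mulmxA PQ' mulmx1.
have -> : P *m diag_mx (map_mx f r) *m Q *m L =
    P *m (diag_mx (map_mx f r) *m W) *m Q'.
  by rewrite {1}LE !mulmxA -[_ *m Q *m P]mulmxA QP mulmx1.
by rewrite fW {1}LE !mulmxA -[_ *m Q' *m P']mulmxA QP' mulmx1.
Qed.

(** Diagonal matrices commute, and the convolution defining the t-product is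
    symmetric in its two factors as soon as their slices commute; hence [D]
    commutes with its transpose. *)
Lemma fdiagonal_diagonalizable n p (D : tensor C n n p.+1) : fdiagonal D ->
  exists r (P Q : 'M[C]_(\sum_(i < p.+1) n)), [/\ P *m Q = 1%:M, Q *m P = 1%:M &
    bcirc D = P *m diag_mx r *m Q].
Proof.
move=> Ddiag; pose P := spectralmx (bcirc D).
have uP : P \in unitmx by exact: spectral_unit.
exists (spectral_diag (bcirc D)), (invmx P), P; rewrite mulVmx ?mulmxV //.
split=> //; apply/orthomx_spectralP/normalmxP.
rewrite -bcirc_tadj -!bcirc_tprod; congr bcirc; apply/ffunP => k.
rewrite !tprodE (reindex_inj (inv_inj (subKr k))) /=; apply: eq_bigr => j _.
rewrite subKr ffunE; have /diag_mxP[a ->] := Ddiag j.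
have /diag_mxP[b ->] := Ddiag (- (k - j)).
by rewrite tr_diag_mx map_diag_mx; apply: diag_mxC.
Qed.

End Diagonalizable.

(** * Derivatives and complex conjugation *)

Section ConjugateDerivatives.

Variable C : numClosedFieldType.

Lemma conj_continuous : continuous (Num.conj : C -> C).
Proof.
move=> z; rewrite /continuous_at.
apply/(@cvgrPdist_lt C C _ _ (nbhs_filter z)) => e e0.
have /(@cvgrPdist_lt C C _ _ (nbhs_filter z))/(_ e e0) : id @ z --> z.
  exact: cvg_id.
by apply: filterS => w; rewrite -rmorphB norm_conjC.
Qed.

Lemma conj_dnbhs0 : Num.conj h @[h --> (0 : C)^'] --> (0 : C)^'.
Proof.
move=> A; rewrite /dnbhs /within /= => A0.
have := @conj_continuous 0; rewrite /continuous_at rmorph0 => /(_ _ A0).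
apply: (@filterS _ _ (nbhs_filter (0 : C))) => h Ah h0.
by apply: Ah; rewrite fmorph_eq0.
Qed.

(** The difference quotient of [g] at the conjugate of [z] with increment [h] is
    the conjugate of the one at [z] with the conjugate increment. *)
Lemma derive1_conj (g : C -> C) z :
  (\forall w \near z, g w^* = (g w)^*) -> derivable g z 1 ->
  derive1 g z^* = (derive1 g z)^*.
Proof.
move=> gC dg; have gz := nbhs_singleton gC.
have g'z : h^-1 *: (g (h + z) - g z) @[h --> (0 : C)^'] --> derive1 g z.
  have e : (fun h : C => h^-1 *: (g (h + z) - g z)) =
      (fun h : C => h^-1 *: ((g \o shift z) (h *: 1) - g z)).
    by apply/funext => h; rewrite /= [_ *: 1]mulr1.
  by rewrite e derive1E.
apply/cvg_lim => //.
have g'C : ((Num.conj h)^-1 *: (g (Num.conj h + z) - g z))^*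
    @[h --> (0 : C)^'] --> (derive1 g z)^*.
  apply: (cvg_comp _ _ (cvg_comp _ _ conj_dnbhs0 g'z)).
  exact: (@conj_continuous (derive1 g z)).
apply: cvg_trans g'C; apply: near_eq_cvg.
have : \forall h \near (0 : C), g (Num.conj h + z)^* = (g (Num.conj h + z))^*.
  have c : Num.conj h + z @[h --> (0 : C)] --> z.
    rewrite -[X in _ --> X]add0r -[X in X + _](rmorph0 Num.conj).
    exact: (cvgD (@conj_continuous 0) (cvg_cst z)).
  exact: c gC.
move=> /nbhs_dnbhs; apply: filterS => h gh.
rewrite -[LHS]/(((Num.conj h)^-1 * (g (Num.conj h + z) - g z))^*).
by rewrite rmorphM rmorphB fmorphV /= conjCK -gh -gz rmorphD /= conjCK.
Qed.

(** By induction on [k], the [k]-th derivative commutes with conjugation on a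
    whole neighbourhood of [z], which [derive1_conj] requires; this is why
    [has_derivn] is needed near [z] and not only at [z]. *)
Lemma derive1n_conj (f : C -> C) (U : set C) k z :
  open U -> (forall w, U w -> f w^* = (f w)^*) -> U z ->
  has_derivn k f z -> derive1n k f z^* = (derive1n k f z)^*.
Proof.
move=> oU fU; elim: k z => [|k IHk] z Uz /=; first by move=> _; apply: fU.
move=> [near_k dk]; apply: derive1_conj => //.
near=> w; apply: IHk; near: w => //.
exact: open_nbhs_nbhs.
Unshelve. all: by end_near. Qed.

End ConjugateDerivatives.

(** * The four properties of tensor functions *)

Theorem theorem2p7 (R : realType) (n p : nat) (A : tensor R[i] n n p.+1)
    (Omega : set R[i]) (f : R[i] -> R[i])
    (hOmega : region Omega)
    (hspec : spectrum (bcirc A) `<=` Omega)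
    (hf : defined_on_spectrum f (bcirc A)) :
  [/\ tfun f A *t A = A *t tfun f A,
      (spectrum (bcirc (tadj A)) `<=` Omega ->
       (forall z, Omega z -> Omega (Num.conj z) ->
          f (Num.conj z) = Num.conj (f z)) ->
       tfun f (tadj A) = tadj (tfun f A)),
      (forall X Xinv : tensor R[i] n n p.+1, tinverse X Xinv ->
       tfun f (X *t A *t Xinv) = X *t tfun f A *t Xinv)
    & (forall X Xinv D : tensor R[i] n n p.+1,
       tinverse X Xinv ->
       A = X *t D *t Xinv ->
       fdiagonal D ->
       (forall i : 'I_n,
          A *t lateral X i = D *t lateral X i /\
          D *t lateral X i = lateral X i *t tube D i i) ->
       forall i : 'I_n,
         tfun f D *t lateral X i = lateral X i *t tfun f (tube D i i))].
Proof.
split.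
- apply: bcirc_inj; rewrite !bcirc_tprod bcirc_tfun.
  exact: mx_horner_intertwine.
- move=> hspecC fC; apply: bcirc_inj.
  rewrite !(bcirc_tfun, bcirc_tadj); apply: matfun_adj => z k Az kz.
  (* the points of [Omega] where the symmetry hypothesis on [f] applies *)
  apply: (@derive1n_conj _ _ (Omega `&` Num.conj @^-1` Omega)).
  + apply: openI; first by case: hOmega.
    apply: open_comp => [w _|]; first exact: conj_continuous.
    by case: hOmega.
  + by move=> w [Ow OCw]; apply: fC.
  + split; first exact: hspec.
    by apply: hspecC; rewrite bcirc_tadj; apply: spectrum_adj.
  + exact: hf.
- move=> X Xinv [XK KX]; apply: bcirc_inj; rewrite !(bcirc_tfun, bcirc_tprod).
  by rewrite matfun_similar // -bcirc_tprod ?XK ?KX bcirc_tid.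
move=> X Xinv D _ _ Ddiag DX i; apply: bcirc_inj.
rewrite !bcirc_tprod !bcirc_tfun.
have [r [P [Q [PQ QP DE]]]] := fdiagonal_diagonalizable Ddiag.
have ddiag : fdiagonal (tube D i i).
  by move=> k; rewrite ffunE scalar_mx_is_diag.
have [r' [P' [Q' [PQ' QP' dE]]]] := fdiagonal_diagonalizable ddiag.
apply: (matfun_diag_intertwine _ PQ QP DE PQ' QP' dE).
by rewrite -!bcirc_tprod (DX i).2.
Qed.
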